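(* Let $\Gamma=(X,R)$ be a bipartite distance-regular graph with diameter $D\ge 4$, valency $k\ge 3$ and eigenvalues $\theta_0>\theta_1>\cdots>\theta_D$. Put $d=\lfloor D/2\rfloor$, fix $x\in X$ and let $T=T(x)$. Choose $n\in\{1,d\}$ if $D$ is odd, and let $n=1$ if $D$ is even. Let $W$ be a thin irreducible $T$-module with endpoint $2$ and local eigenvalue $\tilde\theta_n=-1-\dfrac{b_2b_3}{\theta_n^2-b_2}$. Then $W$ has dimension $D-3$. For $0\le i\le D$, $E_i^*W$ is zero if $i\in\{0,1,D-1,D\}$ and has dimension $1$ if $i\notin\{0,1,D-1,D\}$. Moreover, for $0\le i\le D$, $E_iW$ is zero if $i\in\{0,n,D-n,D\}$ and has dimension $1$ if $i\notin\{0,n,D-n,D\}$.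
   Context: Graphs are finite, undirected, connected, without loops or multiple edges; $\partial$ denotes path-length distance. A graph $\Gamma=(X,R)$ of diameter $D$ is distance-regular if for all $0\le h,i,j\le D$ and all $x,y\in X$ with $\partial(x,y)=h$ the number $p^h_{ij}=|\{z\in X:\partial(x,z)=i,\ \partial(z,y)=j\}|$ depends only on $h,i,j$. Write $c_i=p^i_{1,i-1}$, $b_i=p^i_{1,i+1}$, $k=b_0$ (the valency). $\Gamma$ is bipartite if $X$ can be partitioned into two subsets neither of which contains an edge. For $0\le i\le D$, $A_i\in\mathrm{Mat}_X(\mathbb C)$ is the $i$th distance matrix: its $(y,z)$ entry is $1$ if $\partial(y,z)=i$ and $0$ otherwise; $A=A_1$ is the adjacency matrix. The distinct eigenvalues of $A$ are $\theta_0>\cdots>\theta_D$ (real); $E_i$ is the primitive idempotent of $\theta_i$, i.e. the orthogonal projection of $V=\mathbb C^X$ onto the $\theta_i$-eigenspace of $A$. For bipartite $\Gamma$ with $D\ge4$, $\theta_1^2>b_2>\theta_d^2$. For fixed $x\in X$, $E_i^*=E_i^*(x)$ is the diagonal matrix in $\mathrm{Mat}_X(\mathbb C)$ with $(y,y)$ entry $1$ if $\partial(x,y)=i$ and $0$ otherwise. $T=T(x)$ is the subalgebra of $\mathrm{Mat}_X(\mathbb C)$ generated by $A,E_0^*,\ldots,E_D^*$. A $T$-module is a subspace $W\subseteq V$ with $BW\subseteq W$ for all $B\in T$; it is irreducible if it is nonzero and contains no $T$-modules other than $0$ and $W$. The endpoint of an irreducible $W$ is $\min\{i:E_i^*W\ne0\}$;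 $W$ is thin if $\dim E_i^*W\le1$ for $0\le i\le D$. If $W$ is thin irreducible with endpoint $2$, then $E_2^*W$ is a one-dimensional eigenspace for $E_2^*A_2E_2^*$; the corresponding eigenvalue is called the local eigenvalue of $W$. *)

(* Defs.v *)
From mathcomp Require Import all_boot all_order all_algebra.

Set Implicit Arguments.
Unset Strict Implicit.
Unset Printing Implicit Defensive.

Import Order.TTheory GRing.Theory Num.Theory.
Local Open Scope ring_scope.

Section Graph.
Variables (X : finType) (e : rel X).

Definition connected_simple_graph : Prop :=
  [/\ symmetric e, irreflexive e & forall y z : X, connect e y z].

Definition has_walk (n : nat) (y z : X) : bool :=
  [exists p : n.-tuple X, path e y p && (last y p == z)].

(* Shortest paths have length < #|X|, so the search range is sufficient; the
   value is #|X| when there is no path. *)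
Definition gdist (y z : X) : nat := find (fun n => has_walk n y z) (iota 0 #|X|).

Definition diameter : nat := \max_(p : X * X) gdist p.1 p.2.

Definition triple_count (i j : nat) (y z : X) : nat :=
  #|[set w | (gdist y w == i) && (gdist w z == j)]|.

Definition distance_regular : Prop :=
  connected_simple_graph /\
  forall h i j : nat, (h <= diameter)%N -> (i <= diameter)%N -> (j <= diameter)%N ->
    forall y z y' z' : X, gdist y z = h -> gdist y' z' = h ->
      triple_count i j y z = triple_count i j y' z'.

(* p^h_ij, computed at some pair of vertices at distance h (0 if there is none);
   independent of that pair when the graph is distance-regular. *)
Definition intersection_number (h i j : nat) : nat :=
  if [pick p : X * X | gdist p.1 p.2 == h] is Some p
  then triple_count i j p.1 p.2 else 0%N.

Definition bnum (i : nat) : nat := intersection_number i 1 i.+1.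

Definition valency : nat := bnum 0.

Definition bipartite : Prop :=
  exists Y : {set X}, forall y z : X, e y z -> (y \in Y) != (z \in Y).

End Graph.

(* Vertices index matrices through the enumeration of X; C^X is 'cV[C]_#|X|. *)
Section Matrices.
Variables (C : numClosedFieldType) (X : finType) (e : rel X).

Definition distmx (i : nat) : 'M[C]_#|X| :=
  \matrix_(y, z) (gdist e (enum_val y) (enum_val z) == i)%:R.

Definition adjmx : 'M[C]_#|X| := distmx 1.

(* theta 0 > ... > theta D are exactly the eigenvalues of A; the values of theta
   beyond D are irrelevant. *)
Definition eigenvalue_sequence (theta : nat -> C) : Prop :=
  (forall i j : nat, (i < j <= diameter e)%N -> theta j < theta i) /\
  (forall t : C, eigenvalue adjmx t <->
     exists2 i : nat, (i <= diameter e)%N & t = theta i).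

(* eigenspace and proj_ortho (for the Hermitian dot product) act on row vectors
   from the right; the two transpositions give the orthogonal projection of
   column vectors onto {v | A v = t v}. *)
Definition primitive_idempotent (t : C) : 'M[C]_#|X| :=
  (proj_ortho (eigenspace adjmx^T t))^T.

Definition dual_idempotent (x : X) (i : nat) : 'M[C]_#|X| :=
  diag_mx (\row_y (gdist e x (enum_val y) == i)%:R).

End Matrices.

Inductive generated_subalgebra (C : fieldType) (m : nat) (S : 'M[C]_m -> Prop) :
    'M[C]_m -> Prop :=
| gen_mem B : S B -> generated_subalgebra S B
| gen_scalar a : generated_subalgebra S a%:M
| gen_add B1 B2 : generated_subalgebra S B1 -> generated_subalgebra S B2 ->
    generated_subalgebra S (B1 + B2)
| gen_mul B1 B2 : generated_subalgebra S B1 -> generated_subalgebra S B2 ->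
    generated_subalgebra S (B1 *m B2).

Definition mximage (C : fieldType) (m : nat) (B : 'M[C]_m) (W : {vspace 'cV[C]_m}) :
    {vspace 'cV[C]_m} :=
  (linfun (mulmx B) @: W)%VS.

Section Modules.
Variables (C : numClosedFieldType) (X : finType) (e : rel X) (x : X).
Implicit Types (B : 'M[C]_#|X|) (U W : {vspace 'cV[C]_#|X|}).

Definition terwilliger B : Prop :=
  generated_subalgebra
    (fun G : 'M[C]_#|X| => G = adjmx C e \/
       exists2 i : nat, (i <= diameter e)%N & G = dual_idempotent C e x i) B.

Definition tmodule W : Prop :=
  forall B, terwilliger B -> (mximage B W <= W)%VS.

Definition irreducible_tmodule W : Prop :=
  [/\ tmodule W, W <> 0%VS &
      forall U, tmodule U -> (U <= W)%VS -> U = 0%VS \/ U = W].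

Definition thin W : Prop :=
  forall i : nat, (i <= diameter e)%N ->
    (\dim (mximage (dual_idempotent C e x i) W) <= 1)%N.

Definition endpoint W : nat :=
  find (fun i => mximage (dual_idempotent C e x i) W != 0%VS)
       (iota 0 (diameter e).+1).

(* For a thin irreducible module W with endpoint 2, E*_2 W is a line, so the
   scalar eta is unique. *)
Definition has_local_eigenvalue W (eta : C) : Prop :=
  forall v : 'cV[C]_#|X|, v \in mximage (dual_idempotent C e x 2) W ->
    (dual_idempotent C e x 2 *m distmx C e 2 *m dual_idempotent C e x 2) *m v
    = eta *: v.

End Modules.

(* Main.v *)
Require Import Defs.
From mathcomp Require Import all_boot all_order all_algebra.
From mathcomp Require Import ring zify.

Set Implicit Arguments.
Unset Strict Implicit.
Unset Printing Implicit Defensive.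

Import Order.TTheory GRing.Theory Num.Theory.
Local Open Scope ring_scope.

(** Write Q_i for the primitive idempotent of theta_i and k for the valency.
Being a polynomial in A, Q_i is a combination of distance matrices, that is,
its (y, z) entry is f_i(dist(y, z)) for some function f_i on distances.

Let v span E*_2 W. It is supported on the sphere of radius 2 around x, whose
points are at mutual distance 0, 2 or 4 because the graph is bipartite; its
entries sum to zero because E*_0 W = 0; and the local eigenvalue eta is the
Rayleigh quotient of A_2 at v. Hence
  |Q_i v|^2 = (f_i(0) - f_i(2) + (f_i(2) - f_i(4)) (1 + eta)) |v|^2.
The equation A Q_i = theta_i Q_i is a three-term recurrence for f_i. It gives
b_2 b_3 (f_i(2) - f_i(4)) = (theta_i^2 - b_2) (f_i(0) - f_i(2)), so that for
eta = -1 - b_2 b_3 / (theta_n^2 - b_2) the norm becomes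
  |Q_i v|^2 = (f_i(0) - f_i(2)) (theta_n^2 - theta_i^2) / (theta_n^2 - b_2) |v|^2.
By the same recurrence f_i(0) - f_i(2) is a positive multiple of
k^2 - theta_i^2. As theta_0 = k and theta_(D-i) = - theta_i in a bipartite
graph, Q_i v = 0 exactly for i in {0, n, D - n, D}
(lemma [idem_endpoint2_eq0]).

The quotient makes sense because theta_n^2 differs from b_2
([sqr_theta_neq_b2]). Indeed the Q_i sum to the identity, so summing the
relation between f_i(2) - f_i(4) and f_i(0) - f_i(2) over all i gives
  sum_i (theta_i^2 - b_2) (f_i(0) - f_i(2)) = 0.
The weights f_i(0) - f_i(2) are positive for 0 < i < D, so b_2 lies strictly
between the extreme values of theta_i^2 in that range, and these are attained
at i = 1 and, for odd D, at i = d.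

Finally, in a thin irreducible module the raising part of A maps each E*_j W
onto E*_(j+1) W, and once it vanishes the module is exhausted
([raising_stop]). So the powers of A applied to v span W
([generated_by_endpoint_vector]) and Q_i W is spanned by Q_i v. This gives the
dimensions of the spaces Q_i W, and their sum dim W = D - 3. The spaces E*_j W
have dimension at most 1 and are nonzero on an interval of indices that starts
at 2; as their dimensions also sum to D - 3, the interval is 2, ..., D - 2. *)

(** * Path-length distance *)

Section Distance.
Variables (X : finType) (e : rel X).
Hypothesis graph_e : connected_simple_graph e.

Lemma has_walkP m y z :
  reflect (exists p, [/\ size p = m, path e y p & last y p = z]) (has_walk e m y z).
Proof.
apply: (iffP existsP) => [[p /andP[ep /eqP lp]]|[p [sp ep lp]]].
  by exists p; rewrite size_tuple.
by exists (tcast sp (in_tuple p)); rewrite val_tcast ep lp eqxx.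
Qed.

Lemma gdist_le_walk m y z : has_walk e m y z -> (gdist e y z <= m)%N.
Proof.
move=> wm; rewrite leqNgt; apply/negP => lt_m.
have m_lt: (m < #|X|)%N.
  by apply: leq_trans lt_m _; rewrite -[leqRHS](size_iota 0) find_size.
by have := before_find 0%N lt_m; rewrite nth_iota // add0n wm.
Qed.

(** A walk between two given vertices can be taken without repeated vertices;
    its length is then below the number of vertices, so the bounded search that
    defines the distance succeeds. With the previous lemma this makes the
    distance the least length of a walk. *)
Lemma walk_gdist y z : has_walk e (gdist e y z) y z.
Proof.
have [_ _ conn] := graph_e; have /connectP[p ep ->{z}] := conn y z.
have [q eq uq _] := shortenP ep.
have has_q : has (fun m => has_walk e m y (last y q)) (iota 0 #|X|).
  apply/hasP; exists (size q); last by apply/has_walkP; exists q.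
  by rewrite mem_iota add0n; move/card_uniqP: uq => /= <-; exact: max_card.
have := nth_find 0%N has_q; rewrite nth_iota ?add0n //.
by move: has_q; rewrite has_find size_iota.
Qed.

Lemma gdist_sym y z : gdist e y z = gdist e z y.
Proof.
have [symE _ _] := graph_e.
wlog suff le_yz : y z / (gdist e y z <= gdist e z y)%N.
  by apply/eqP; rewrite eqn_leq !le_yz.
have /has_walkP[p [sp ep lp]] := walk_gdist z y.
apply/gdist_le_walk/has_walkP; exists (rev (belast z p)).
rewrite size_rev size_belast sp; split=> //.
  by rewrite -lp rev_path (eq_path (e' := e)) // => a b; rewrite symE.
by case: p {sp ep} lp => [<-//|a p] /= _; rewrite rev_cons last_rcons.
Qed.

Lemma gdist_eq0 y z : (gdist e y z == 0%N) = (y == z).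
Proof.
apply/eqP/eqP => [d0|->].
  by have /has_walkP[p [+ _ <-]] := walk_gdist y z; rewrite d0 => /size0nil->.
by apply/eqP; rewrite -leqn0; apply/gdist_le_walk/has_walkP; exists [::].
Qed.

Lemma gdistxx y : gdist e y y = 0%N.
Proof. by apply/eqP; rewrite gdist_eq0. Qed.

Lemma gdist_leS y w z : e y w -> (gdist e y z <= (gdist e w z).+1)%N.
Proof.
move=> eyw; have /has_walkP[p [sp ep lp]] := walk_gdist w z.
by apply/gdist_le_walk/has_walkP; exists (w :: p); rewrite /= sp eyw ep.
Qed.

Lemma gdist_triangle y w z : (gdist e y z <= gdist e y w + gdist e w z)%N.
Proof.
have /has_walkP[p [sp ep lp]] := walk_gdist y w.
have /has_walkP[q [sq eq lq]] := walk_gdist w z.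
apply/gdist_le_walk/has_walkP; exists (p ++ q).
by rewrite size_cat cat_path last_cat sp sq ep lp eq lq.
Qed.

Lemma gdist_pred y z i : gdist e y z = i.+1 -> exists2 w, e y w & gdist e w z = i.
Proof.
move=> dyz; have := walk_gdist y z; rewrite dyz.
case/has_walkP=> -[|w p] [//= [sp] /andP[eyw ep] lp]; exists w => //; apply/eqP.
rewrite eqn_leq -[(i <= _)%N]ltnS -[X in _ && (X <= _)%N]dyz gdist_leS // andbT.
by apply/gdist_le_walk/has_walkP; exists p.
Qed.

Lemma gdist_eq1 y z : (gdist e y z == 1%N) = e y z.
Proof.
have [_ irrE _] := graph_e.
apply/eqP/idP => [/gdist_pred[w eyw /eqP]|eyz]; first by rewrite gdist_eq0 => /eqP<-.
apply/eqP; rewrite eqn_leq lt0n gdist_eq0; apply/andP; split.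
  by have := gdist_leS z eyz; rewrite gdistxx.
by apply: contraTneq eyz => ->; rewrite irrE.
Qed.

Lemma gdist_le_diameter y z : (gdist e y z <= diameter e)%N.
Proof. exact: (@bigop.leq_bigmax _ (fun p : X * X => gdist e p.1 p.2) (y, z)). Qed.

Lemma gdist_attained h : (0 < #|X|)%N -> (h <= diameter e)%N ->
  exists p : X * X, gdist e p.1 p.2 = h.
Proof.
move=> X_gt0.
have : exists p : X * X, gdist e p.1 p.2 = diameter e.
  have [|p dp] := @bigop.eq_bigmax _ (fun p : X * X => gdist e p.1 p.2).
    by rewrite card_prod muln_gt0 X_gt0.
  by exists p; rewrite -dp.
move: (diameter e) => m [p]; elim: m p => [|m IHm] [y z] /= dyz.
  by rewrite leqn0 => /eqP->; exists (y, z).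
rewrite leq_eqVlt => /orP[/eqP->|]; first by exists (y, z).
by have [w _ dwz] := gdist_pred dyz; apply: IHm (w, z) dwz.
Qed.

(** Every step of a walk changes the colour class. *)
Lemma odd_gdist (Y : {set X}) :
  (forall y z, e y z -> (y \in Y) != (z \in Y)) ->
  forall y z, odd (gdist e y z) = ((y \in Y) != (z \in Y)).
Proof.
move=> bipY y z; have [m dyz] := ubnP (gdist e y z).
elim: m y dyz => // m IHm y; case dyz: (gdist e y z) => [|i] le_i.
  by move/eqP: dyz; rewrite gdist_eq0 => /eqP->; rewrite eqxx.
have [w eyw dwz] := gdist_pred dyz; rewrite /= -dwz IHm ?dwz //.
by move: (bipY _ _ eyw); do 3!case: (_ \in Y).
Qed.

Lemma gdist_neighbour : bipartite e -> forall y w z, e y w ->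
  gdist e w z = (gdist e y z).+1 \/ gdist e y z = (gdist e w z).+1.
Proof.
move=> [Y bipY] y w z eyw; have [symE _ _] := graph_e.
have le1 := gdist_leS z eyw.
have le2 : (gdist e w z <= (gdist e y z).+1)%N by apply: gdist_leS; rewrite symE.
have : odd (gdist e y z) != odd (gdist e w z).
  by rewrite !(odd_gdist bipY); move: (bipY _ _ eyw); do 3!case: (_ \in Y).
move: le1; rewrite leq_eqVlt ltnS => /orP[/eqP|]; first by right.
move: le2; rewrite leq_eqVlt ltnS => /orP[/eqP|]; first by left.
by move=> wy yw; rewrite (@anti_leq (gdist e y z) (gdist e w z)) ?eqxx // yw.
Qed.

End Distance.

(** * Matrices that depend only on the distance *)

Section DistanceRegular.
Variables (C : numClosedFieldType) (X : finType) (e : rel X).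
Hypotheses (drg_e : distance_regular e) (bip_e : bipartite e).
Hypothesis diam_ge4 : (4 <= diameter e)%N.

Let graph_e : connected_simple_graph e := drg_e.1.
Local Notation A := (adjmx C e).
Local Notation b := (bnum e).

(** The number c_h, with the convention c_0 = 0. *)
Definition cnum h := if h is h'.+1 then intersection_number e h 1 h' else 0%N.
Arguments cnum : simpl never.

(** The element sum_h f(h) A_h of the Bose-Mesner algebra. *)
Definition distfun_mx (f : nat -> C) : 'M[C]_#|X| :=
  \matrix_(y, z) f (gdist e (enum_val y) (enum_val z)).
Local Notation M := distfun_mx.

Lemma card_vertices_gt0 : (0 < #|X|)%N.
Proof.
rewrite lt0n; apply: contraTneq diam_ge4 => /card0_eq X0.
by rewrite /diameter big_pred0 // => -[y z]; have := X0 y; rewrite inE.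
Qed.

Lemma triple_count_intersection i j y z :
  (i <= diameter e)%N -> (j <= diameter e)%N ->
  triple_count e i j y z = intersection_number e (gdist e y z) i j.
Proof.
move=> le_i le_j; rewrite /intersection_number; case: pickP => [[y' z'] /= /eqP dyz|].
  by apply: (drg_e.2 (gdist e y z)) => //; exact: gdist_le_diameter.
by move/(_ (y, z)); rewrite /= eqxx.
Qed.

(** Distance-regularity only speaks of distances up to D. At distance D both
    sides count vertices at distance D + 1, of which there are none. *)
Lemma triple_count_bnum y z :
  triple_count e 1 (gdist e y z).+1 y z = b (gdist e y z).
Proof.
have D_gt0 : (0 < diameter e)%N by apply: leq_trans diam_ge4.
have [lt_D|ge_D] := ltnP (gdist e y z) (diameter e).
  exact: triple_count_intersection.
have no_far u w : (gdist e u w == (gdist e y z).+1) = false.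
  by apply/eqP => duw; have := gdist_le_diameter e u w; rewrite duw ltnNge ge_D.
have count0 u w : triple_count e 1 (gdist e y z).+1 u w = 0%N.
  by apply: eq_card0 => v; rewrite inE no_far andbF.
by rewrite count0 /bnum /intersection_number; case: pickP => // p _; rewrite count0.
Qed.

Lemma triple_count_cnum y z h :
  gdist e y z = h.+1 -> triple_count e 1 h y z = cnum h.+1.
Proof.
move=> dyz; rewrite /cnum -dyz; apply: triple_count_intersection.
  exact: leq_trans diam_ge4.
by apply: leq_trans (gdist_le_diameter e y z); rewrite dyz.
Qed.

Lemma triple_count_sum i j y z :
  (triple_count e i j y z)%:R
    = \sum_(w : X) ((gdist e y w == i) && (gdist e w z == j))%:R :> C.
Proof.
rewrite /triple_count -sum1dep_card natr_sum [LHS]big_mkcond.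
by apply: eq_bigr => w _; case: ifP.
Qed.

(** The neighbours of y are at distance one more or one less than y from a
    given vertex, because the graph is bipartite; so the product with A only
    involves the numbers b_h and c_h. *)
Lemma adjmx_mul_distfun f :
  A *m M f = M (fun h => (b h)%:R * f h.+1 + (cnum h)%:R * f h.-1).
Proof.
apply/matrixP => y z; rewrite !mxE.
under eq_bigr => w _ do rewrite !mxE.
move: (enum_val y) (enum_val z) => {y z} y z.
rewrite -(big_enum_val (fun w => (gdist e y w == 1%N)%:R * f (gdist e w z))) /=.
rewrite -triple_count_bnum triple_count_sum mulr_suml.
case dyz: (gdist e y z) => [|h].
  rewrite mul0r addr0; apply: eq_bigr => w _.
  case yw: (_ == 1%N); last by rewrite !mul0r.
  rewrite gdist_eq1 // in yw.
  by have [->|] := gdist_neighbour graph_e bip_e z yw; rewrite dyz // eqxx.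
rewrite -(triple_count_cnum dyz) triple_count_sum mulr_suml -big_split /=.
apply: eq_bigr => w _; case yw: (_ == 1%N); last by rewrite !mul0r addr0.
rewrite gdist_eq1 // in yw; have [->|] := gdist_neighbour graph_e bip_e z yw.
  by rewrite dyz eqxx (gtn_eqF (leqnSn _)) mul0r addr0.
by rewrite dyz => -[<-]; rewrite eqxx (ltn_eqF (leqnSn _)) mul0r add0r.
Qed.

Lemma distfun_mx_inj f g : M f = M g -> forall h, (h <= diameter e)%N -> f h = g h.
Proof.
move=> eqM h le_h; have [[y z] /= dyz] := gdist_attained graph_e card_vertices_gt0 le_h.
by move/matrixP/(_ (enum_rank y) (enum_rank z)): eqM; rewrite !mxE !enum_rankK dyz.
Qed.

Lemma tr_distfun_mx f : (M f)^T = M f.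
Proof. by apply/matrixP => y z; rewrite !mxE gdist_sym. Qed.

Lemma adjmx_distfun : A = M (fun h => (h == 1%N)%:R).
Proof. by []. Qed.

Lemma scalar_distfun a : a%:M = M (fun h => a *+ (h == 0%N)).
Proof.
by apply/matrixP => y z; rewrite !mxE gdist_eq0 // (inj_eq enum_val_inj).
Qed.

Lemma cnum1 : cnum 1 = 1%N.
Proof.
have D_gt0 : (0 < diameter e)%N by apply: leq_trans diam_ge4.
have [[y z] /= dyz] := gdist_attained graph_e card_vertices_gt0 D_gt0.
rewrite -(triple_count_cnum dyz); apply/eqP/cards1P; exists z.
apply/setP => w; rewrite !inE gdist_eq0 // andbC; case: eqP => [->|//].
by rewrite dyz.
Qed.

Lemma cnum_gt0 h : (h < diameter e)%N -> (0 < cnum h.+1)%N.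
Proof.
move=> lt_h; have [[y z] /= dyz] := gdist_attained graph_e card_vertices_gt0 lt_h.
have [w eyw dwz] := gdist_pred graph_e dyz.
rewrite -(triple_count_cnum dyz); apply/card_gt0P; exists w.
by rewrite inE dwz eqxx gdist_eq1 // eyw.
Qed.

Lemma bnum_gt0 h : (h < diameter e)%N -> (0 < b h)%N.
Proof.
move=> lt_h; have [[y z] /= dyz] := gdist_attained graph_e card_vertices_gt0 lt_h.
have [w eyw dwz] := gdist_pred graph_e dyz; have [symE _ _] := graph_e.
rewrite -dwz -triple_count_bnum; apply/card_gt0P; exists y.
by rewrite inE dyz dwz eqxx gdist_eq1 // symE eyw.
Qed.

(** The row sums of A, computed as entries of the product of A and the all-one
    matrix at a diagonal position and at a position at distance h. *)
Lemma bnum_cnum h : (h <= diameter e)%N -> (b h + cnum h = valency e)%N.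
Proof.
have [symE _ _] := graph_e => le_h.
have [[y z] /= <-] := gdist_attained graph_e card_vertices_gt0 le_h.
have := adjmx_mul_distfun (fun=> 1) => /matrixP eqM.
have := eqM (enum_rank y) (enum_rank y).
have -> : (A *m M (fun=> 1)) (enum_rank y) (enum_rank y)
        = (A *m M (fun=> 1)) (enum_rank y) (enum_rank z).
  by rewrite !mxE; apply: eq_bigr => w _; rewrite !mxE.
rewrite eqM !mxE !enum_rankK gdistxx // !mulr1 addr0 -natrD.
by move/eqP; rewrite eqr_nat => /eqP.
Qed.

(** The product formula turns an eigenvalue equation for a distance-dependent
    matrix into a three-term recurrence, whose first four equations relate f 0,
    f 2 and f 4. *)
Section Eigenmatrix.
Variables (t : C) (f : nat -> C).
Hypothesis AM : A *m M f = t *: M f.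

Lemma eigen_recurrence h : (h <= diameter e)%N ->
  (b h)%:R * f h.+1 + (cnum h)%:R * f h.-1 = t * f h.
Proof.
move=> le_h; have: M (fun h => (b h)%:R * f h.+1 + (cnum h)%:R * f h.-1)
                 = M (fun h => t * f h).
  by rewrite -adjmx_mul_distfun AM; apply/matrixP => y z; rewrite !mxE.
by move/distfun_mx_inj => /(_ h le_h).
Qed.

Lemma eigen_f1 : (valency e)%:R * f 1%N = t * f 0%N.
Proof. by have := eigen_recurrence (leq0n _); rewrite mul0r addr0. Qed.

Let kE h : (h <= diameter e)%N -> (cnum h)%:R = (valency e)%:R - (b h)%:R :> C.
Proof. by move=> le_h; rewrite -(bnum_cnum le_h) addnC natrD addrK. Qed.

Let le_D h : (h <= 4)%N -> (h <= diameter e)%N.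
Proof. by move/leq_trans; apply. Qed.

Let b1E : (b 1)%:R = (valency e)%:R - 1 :> C.
Proof. by rewrite -(@bnum_cnum 1) ?le_D // cnum1 natrD addrK. Qed.

Lemma eigen_f2 :
  (valency e)%:R * (b 1)%:R * (f 0%N - f 2%N) = ((valency e)%:R ^+ 2 - t ^+ 2) * f 0%N.
Proof.
have e1 := eigen_f1.
have /= := @eigen_recurrence 1%N (@le_D 1%N isT); rewrite cnum1 mul1r => e2.
move: e1 e2; rewrite b1E; move: (valency e)%:R => k e1 e2.
apply/eqP; rewrite -subr_eq0; apply/eqP.
(* f 1 is eliminated from the recurrences at h = 0 and h = 1. *)
transitivity (- t * (k * f 1%N - t * f 0%N)
   - k * ((k - 1) * f 2%N + f 0%N - t * f 1%N)); first by ring.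
by rewrite e1 e2; ring.
Qed.

Lemma eigen_f4 :
  (b 2)%:R * (b 3)%:R * (f 2%N - f 4%N) = (t ^+ 2 - (b 2)%:R) * (f 0%N - f 2%N).
Proof.
have e1 := eigen_f1.
have /= := @eigen_recurrence 1%N (@le_D 1%N isT); rewrite cnum1 mul1r => e2.
have := @eigen_recurrence 2%N (@le_D 2%N isT); rewrite kE ?le_D // => e3.
have := @eigen_recurrence 3%N (@le_D 3%N isT); rewrite kE ?le_D // => e4.
move: e1 e2 e3 e4; rewrite b1E /=; move: (valency e)%:R (b 2)%:R (b 3)%:R => k b2 b3.
move=> e1 e2 e3 e4; apply/eqP; rewrite -subr_eq0; apply/eqP.
(* f 3 and f 1 are eliminated from the recurrences at h = 3, 2, 0 and 1. *)
transitivity (- b2 * (b3 * f 4%N + (k - b3) * f 2%N - t * f 3%N)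
  - t * (b2 * f 3%N + (k - b2) * f 1%N - t * f 2%N) + t * (k * f 1%N - t * f 0%N)
  + b2 * ((k - 1) * f 2%N + f 0%N - t * f 1%N)); first by ring.
by rewrite e1 e2 e3 e4; ring.
Qed.

End Eigenmatrix.

End DistanceRegular.

(** * Functional calculus of a Hermitian matrix *)

Section HermitianCalculus.
Local Open Scope sesquilinear_scope.
Variables (C : numClosedFieldType) (m : nat) (A : 'M[C]_m).
Hypothesis hermA : A^t* = A.

Let P := spectralmx A.
Let sp := spectral_diag A.

(** The matrix q(A), for an arbitrary function q on the spectrum. Spectral
    projectors are values of this calculus at indicator functions, for which
    the usual relations are evident, and also at interpolation polynomials,
    which places them in the algebra generated by A. *)
Definition fun_mx (q : C -> C) : 'M[C]_m := P^t* *m diag_mx (map_mx q sp) *m P.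

Lemma unitary_mulmxC : P *m P^t* = 1%:M.
Proof. exact/unitarymxP/spectral_unitarymx. Qed.

Lemma unitary_mulCmx : P^t* *m P = 1%:M.
Proof. exact/mulmx1C/unitary_mulmxC. Qed.

Lemma fun_mx_id : fun_mx id = A.
Proof.
have /orthomx_spectralP defA : A \is normalmx by apply/normalmxP; rewrite hermA.
rewrite [RHS]defA invmx_unitary ?spectral_unitarymx //.
rewrite /fun_mx; congr (_ *m diag_mx _ *m _).
by apply/matrixP => i j; rewrite mxE.
Qed.

Lemma eq_fun_mx q r : (forall l, q (sp 0 l) = r (sp 0 l)) -> fun_mx q = fun_mx r.
Proof.
move=> eq_qr; rewrite /fun_mx; congr (_ *m diag_mx _ *m _).
by apply/rowP => l; rewrite !mxE.
Qed.

Lemma fun_mxD q r : fun_mx q + fun_mx r = fun_mx (fun s => q s + r s).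
Proof.
rewrite /fun_mx -mulmxDl -mulmxDr; congr (_ *m _ *m _).
by apply/matrixP => i j; rewrite !mxE mulrnDl.
Qed.

Lemma fun_mxM q r : fun_mx q *m fun_mx r = fun_mx (fun s => q s * r s).
Proof.
rewrite /fun_mx !mulmxA mulmxtVK ?spectral_unitarymx //.
rewrite -(mulmxA _ (diag_mx _) (diag_mx _)) mulmx_diag; congr (_ *m diag_mx _ *m _).
by apply/rowP => l; rewrite !mxE.
Qed.

Lemma fun_mx_cst c : fun_mx (fun=> c) = c%:M.
Proof.
have -> : fun_mx (fun=> c) = P^t* *m c%:M *m P.
  by rewrite /fun_mx; congr (_ *m _ *m _); apply/matrixP => i j; rewrite !mxE.
by rewrite mul_mx_scalar -scalemxAl unitary_mulCmx scalemx1.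
Qed.

Lemma fun_mx0 : fun_mx (fun=> 0) = 0.
Proof. by rewrite fun_mx_cst raddf0. Qed.

Lemma fun_mx_sum (I : Type) (r : seq I) (q : I -> C -> C) :
  \sum_(i <- r) fun_mx (q i) = fun_mx (fun s => \sum_(i <- r) q i s).
Proof.
elim: r => [|i r IHr].
  rewrite big_nil (@eq_fun_mx _ (fun=> 0)); last by move=> l; rewrite big_nil.
  by rewrite fun_mx0.
rewrite big_cons IHr fun_mxD; apply: eq_fun_mx => l.
by rewrite big_cons.
Qed.

Lemma fun_mx_herm q : (forall s, (q s)^* = q s) -> (fun_mx q)^t* = fun_mx q.
Proof.
move=> qJ; rewrite /fun_mx !trmx_mul !map_mxM trmxCK mulmxA tr_diag_mx map_diag_mx.
by congr (_ *m diag_mx _ *m _); apply/rowP => l; rewrite !mxE; exact: qJ.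
Qed.

Lemma spectral_diag_eigenvalue l : eigenvalue A (sp 0 l).
Proof.
apply/eigenvalueP; exists (row l P).
  rewrite -{1}fun_mx_id /fun_mx -row_mul !mulmxA unitary_mulmxC mul1mx row_mul.
  by apply/rowP => j; rewrite row_diag_mx -scalemxAl -rowE !mxE.
apply: contraTneq (oner_neq0 C) => Pl0; rewrite negbK.
have := congr1 (fun B : 'M_m => B l l) unitary_mulmxC.
by rewrite !mxE eqxx -(mulr1n 1) => <-; rewrite big1 // => j _;
   move/rowP/(_ j): Pl0; rewrite !mxE => ->; rewrite mul0r.
Qed.

(** Horner's scheme: what is preserved by B |-> A B + c holds for every
    polynomial in A. *)
Lemma fun_mx_horner_ind (K : 'M[C]_m -> Prop) (p : {poly C}) :
  K 0 -> (forall B c, K B -> K (A *m B + c%:M)) -> K (fun_mx (horner p)).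
Proof.
move=> K0 KS; elim/poly_ind: p => [|p c IHp].
  have -> // : fun_mx (horner 0) = 0.
  rewrite (@eq_fun_mx _ (fun=> 0)) ?fun_mx0 // => l.
  by rewrite horner0.
have -> : fun_mx (horner (p * 'X + c%:P)) = A *m fun_mx (horner p) + c%:M.
  rewrite -{1}fun_mx_id fun_mxM -fun_mx_cst fun_mxD; apply: eq_fun_mx => l.
  by rewrite !hornerE mulrC.
exact: KS.
Qed.

Definition spectral_proj (t : C) : 'M[C]_m := fun_mx (fun s => (s == t)%:R).

Lemma spectral_proj_herm t : (spectral_proj t)^t* = spectral_proj t.
Proof. by apply: fun_mx_herm => s; rewrite conjC_nat. Qed.

Lemma spectral_projM t u :
  spectral_proj t *m spectral_proj u = if t == u then spectral_proj t else 0.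
Proof.
rewrite fun_mxM; case: eqP => [->|/eqP tu].
  by apply: eq_fun_mx => l; case: eqP => _; rewrite ?mulr1 ?mulr0.
rewrite (@eq_fun_mx _ (fun=> 0)) ?fun_mx0 // => l.
by have [->|] := eqVneq _ t; rewrite ?(negPf tu) ?mulr0 ?mul0r.
Qed.

Lemma spectral_proj_eigen t : A *m spectral_proj t = t *: spectral_proj t.
Proof.
rewrite -mul_scalar_mx -fun_mx_cst -{1}fun_mx_id !fun_mxM; apply: eq_fun_mx => l.
by case: eqP => [->|]; rewrite ?mulr0.
Qed.

(** On the spectrum 1 = [s = t] + (s - t) (s - t)^-1, including at s = t where
    the inverse of 0 is 0. Hence what A - t annihilates is fixed by the
    projector. *)
Lemma spectral_proj_compl t :
  1%:M = spectral_proj t + (A - t%:M) *m fun_mx (fun s => (s - t)^-1).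
Proof.
have -> : A - t%:M = fun_mx (fun s => s - t).
  by rewrite -(raddfN (@scalar_mx C m)) /= -fun_mx_cst -[X in X + _]fun_mx_id fun_mxD.
rewrite -fun_mx_cst fun_mxM fun_mxD; apply: eq_fun_mx => l.
case: eqP => [->|/eqP]; first by rewrite subrr mul0r addr0.
by rewrite -subr_eq0 => nz; rewrite divff ?add0r.
Qed.

Lemma eigen_mul_spectral_proj r t (U : 'M[C]_(r, m)) :
  U *m A = t *: U -> U *m spectral_proj t = U.
Proof.
move=> UA; rewrite -[RHS]mulmx1 {1}(spectral_proj_compl t) mulmxDr mulmxA.
by rewrite mulmxBr UA mul_mx_scalar subrr mul0mx addr0.
Qed.

Lemma spectral_proj_neq0 t : eigenvalue A t -> spectral_proj t != 0.
Proof.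
move=> /eigenvalueP[u uA]; apply: contraNneq => Q0.
by rewrite -(eigen_mul_spectral_proj uA) Q0 mulmx0.
Qed.

Lemma spectral_proj_comm t : spectral_proj t *m A = t *: spectral_proj t.
Proof.
rewrite -spectral_proj_eigen -[X in _ *m X = _]fun_mx_id -[X in _ = X *m _]fun_mx_id.
by rewrite !fun_mxM; apply: eq_fun_mx => l; rewrite mulrC.
Qed.

Lemma proj_ortho_eigenspace t : proj_ortho (eigenspace A t) = spectral_proj t.
Proof.
set E := eigenspace A t; set Q := spectral_proj t.
have EQ : E *m Q = E by apply: eigen_mul_spectral_proj; exact/eigenspaceP.
rewrite -[LHS]mul1mx -[1%:M](subrK Q) mulmxDl addrC.
rewrite proj_ortho_id; last by apply/eigenspaceP; exact: spectral_proj_comm.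
rewrite proj_ortho_0 ?addr0 //; apply/orthomx1P.
by rewrite mulmxBl mul1mx /Q -{1}spectral_proj_herm -map_mxM -trmx_mul -/Q EQ subrr.
Qed.

End HermitianCalculus.

(** * The spectrum of a bipartite distance-regular graph *)

Section SquaredNorm.
Local Open Scope sesquilinear_scope.
Variables (C : numClosedFieldType) (m : nat).
Implicit Types v : 'cV[C]_m.

Definition sqnorm v : C := (v^t* *m v) 0 0.

Lemma sqnorm_ge0 v : 0 <= sqnorm v.
Proof.
by rewrite /sqnorm mxE sumr_ge0 // => j _; rewrite !mxE mulrC mul_conjC_ge0.
Qed.

Lemma sqnorm_eq0 v : (sqnorm v == 0) = (v == 0).
Proof.
apply/eqP/eqP => [|->]; last by rewrite /sqnorm mulmx0 mxE.
rewrite /sqnorm mxE => /psumr_eq0P v0; apply/colP => j; rewrite [RHS]mxE.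
apply/eqP; rewrite -mul_conjC_eq0 mulrC.
have := v0 _ j isT; rewrite !mxE => -> // l _.
by rewrite !mxE mulrC mul_conjC_ge0.
Qed.

Lemma sqnorm_proj (Q : 'M[C]_m) v : Q^t* = Q -> Q *m Q = Q ->
  sqnorm (Q *m v) = (v^t* *m (Q *m v)) 0 0.
Proof.
by move=> hQ QQ; rewrite /sqnorm trmx_mul map_mxM hQ -mulmxA (mulmxA Q) QQ.
Qed.

End SquaredNorm.

Section Spectrum.
Local Open Scope sesquilinear_scope.
Variables (C : numClosedFieldType) (X : finType) (e : rel X) (theta : nat -> C).
Hypotheses (drg_e : distance_regular e) (bip_e : bipartite e).
Hypotheses (diam_ge4 : (4 <= diameter e)%N).
Hypothesis theta_e : eigenvalue_sequence e theta.

Let graph_e : connected_simple_graph e := drg_e.1.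
Local Notation A := (adjmx C e).
Local Notation D := (diameter e).
Local Notation k := ((valency e)%:R : C).
Local Notation M := (@distfun_mx C X e).

Lemma tr_adjmx : A^T = A.
Proof. by rewrite adjmx_distfun tr_distfun_mx. Qed.

Lemma adjmx_herm : A^t* = A.
Proof. by rewrite tr_adjmx; apply/matrixP => y z; rewrite !mxE; exact: conjC_nat. Qed.

Lemma theta_lt i j : (i < j <= D)%N -> theta j < theta i.
Proof. by case: theta_e => lt_th _ /lt_th. Qed.

Lemma theta_eigenvalue i : (i <= D)%N -> eigenvalue A (theta i).
Proof. by move=> le_i; apply/theta_e.2; exists i. Qed.

Lemma theta_inj i j : (i <= D)%N -> (j <= D)%N -> (theta i == theta j) = (i == j).
Proof.
move=> le_i le_j; apply/eqP/eqP => [eq_t|->//].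
have [lt_ij|lt_ij|//] := ltngtP i j.
  by have := @theta_lt i j; rewrite lt_ij le_j eq_t ltxx => /(_ isT).
by have := @theta_lt j i; rewrite lt_ij le_i eq_t ltxx => /(_ isT).
Qed.

(** The primitive idempotent of theta_i, as a spectral projector of A. *)
Definition idem i := spectral_proj A (theta i).

Lemma primitive_idempotentE i : primitive_idempotent e (theta i) = (idem i)^T.
Proof.
by rewrite /primitive_idempotent tr_adjmx (proj_ortho_eigenspace adjmx_herm).
Qed.

Lemma idem_sum1 : \sum_(i < D.+1) idem i = 1%:M.
Proof.
rewrite /idem /spectral_proj (fun_mx_sum A (index_enum _)
  (fun i : 'I_D.+1 => fun s => (s == theta i)%:R)) -(fun_mx_cst A).
apply: eq_fun_mx => l.
have /theta_e.2[i le_i ->] := spectral_diag_eigenvalue adjmx_herm l.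
rewrite (bigD1 (Ordinal (le_i : i < D.+1)%N)) //= eqxx big1 ?addr0 // => j ne_j.
rewrite (theta_inj le_i (leq_ord j)); case: eqP => // ij; case/eqP: ne_j.
exact: val_inj.
Qed.

Lemma idemM i j : (i <= D)%N -> (j <= D)%N ->
  idem i *m idem j = if i == j then idem i else 0.
Proof. by move=> le_i le_j; rewrite spectral_projM theta_inj. Qed.

Lemma idem_herm i : (idem i)^t* = idem i.
Proof. exact: spectral_proj_herm. Qed.

Lemma idem_adjmx i : idem i *m A = theta i *: idem i.
Proof. exact: (spectral_proj_comm adjmx_herm). Qed.

(** On the spectrum the indicator function of theta_i agrees with a Lagrange
    interpolation polynomial, so the idempotent is a polynomial in A. *)
Lemma idem_ind (K : 'M[C]_#|X| -> Prop) i : (i <= D)%N ->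
  K 0 -> (forall B c, K B -> K (A *m B + c%:M)) -> K (idem i).
Proof.
move=> le_i K0 KS.
pose L := \prod_(j < D.+1 | j != i :> nat)
  ((theta i - theta j)^-1 *: ('X - (theta j)%:P)).
suff -> : idem i = fun_mx A (horner L).
  by apply: fun_mx_horner_ind K0 KS; exact: adjmx_herm.
apply: eq_fun_mx => l.
have /theta_e.2[j le_j ->] := spectral_diag_eigenvalue adjmx_herm l.
rewrite theta_inj // /L horner_prod; have [->|ne_ji] := eqVneq.
  rewrite big1 // => m ne_m; rewrite !hornerE mulVf // subr_eq0.
  by rewrite (theta_inj le_i (leq_ord m)) eq_sym.
by rewrite (bigD1 (Ordinal (le_j : j < D.+1)%N)) //= !hornerE subrr mulr0 mul0r.
Qed.

(** The coefficient of A_h in the idempotent, read off at some pair of vertices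
    at distance h; a default value is taken at distances that do not occur. *)
Definition idem_coef i h :=
  if [pick p : X * X | gdist e p.1 p.2 == h] is Some p
  then idem i (enum_rank p.1) (enum_rank p.2) else 0.

Lemma idem_distfun i : (i <= D)%N -> idem i = M (idem_coef i).
Proof.
move=> le_i; have [f fE] : exists f, idem i = M f.
  apply: (idem_ind (K := fun B => exists f, B = M f)) => //.
    by exists (fun=> 0); apply/matrixP => y z; rewrite !mxE.
  move=> B c [f ->]; rewrite (adjmx_mul_distfun drg_e bip_e diam_ge4).
  rewrite (scalar_distfun drg_e); set f1 := (X in M X + _); set f2 := (X in _ + M X).
  by exists (fun h => f1 h + f2 h); apply/matrixP => y z; rewrite !mxE.
apply/matrixP => y z; rewrite [RHS]mxE /idem_coef; case: pickP => [p /eqP dp|].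
  by rewrite fE !mxE !enum_rankK dp.
by move/(_ (enum_val y, enum_val z)); rewrite /= eqxx.
Qed.

Lemma primitive_idempotent_idem i : (i <= D)%N ->
  primitive_idempotent e (theta i) = idem i.
Proof.
by move=> le_i; rewrite primitive_idempotentE idem_distfun // (tr_distfun_mx drg_e).
Qed.

Lemma idem_eigen i : (i <= D)%N -> A *m M (idem_coef i) = theta i *: M (idem_coef i).
Proof. by move=> le_i; rewrite -idem_distfun // (spectral_proj_eigen adjmx_herm). Qed.

Lemma sum_idem_coef h : (0 < h <= D)%N -> \sum_(i < D.+1) idem_coef i h = 0.
Proof.
case/andP=> h_gt0 le_h.
have [[y z] /= dyz] := gdist_attained graph_e (card_vertices_gt0 diam_ge4) le_h.
have /matrixP/(_ (enum_rank y) (enum_rank z)) := idem_sum1.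
rewrite summxE mxE (inj_eq enum_rank_inj) -(gdist_eq0 graph_e) dyz (gtn_eqF h_gt0).
rewrite mulr0n => sum0; rewrite -[RHS]sum0.
apply: eq_bigr => i _; rewrite (idem_distfun (leq_ord i)).
by rewrite !mxE !enum_rankK dyz.
Qed.

(** All diagonal entries equal the coefficient of A_0, and the diagonal entry of
    an orthogonal projector is the squared norm of its column. If it vanished,
    so would the projector. *)
Lemma idem_coef0_gt0 i : (i <= D)%N -> 0 < idem_coef i 0.
Proof.
move=> le_i; have Qn0 := spectral_proj_neq0 adjmx_herm (theta_eigenvalue le_i).
have sq_col y : sqnorm (idem i *m delta_mx y 0) = idem_coef i 0.
  rewrite sqnorm_proj ?idem_herm ?idemM ?eqxx // -colE.
  by rewrite trmx_delta map_delta_mx -rowE idem_distfun // !mxE gdistxx.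
rewrite lt_def; apply/andP; split; last first.
  have /card_gt0P[y _] := card_vertices_gt0 diam_ge4.
  by rewrite -(sq_col (enum_rank y)) sqnorm_ge0.
apply: contraNneq Qn0 => f0; apply/eqP/matrixP => y z; rewrite [RHS]mxE.
have /eqP : sqnorm (idem i *m delta_mx z 0) = 0 by rewrite sq_col.
by rewrite sqnorm_eq0 -colE => /eqP/colP/(_ y); rewrite !mxE.
Qed.

Lemma valency_eigenvalue : eigenvalue A k.
Proof.
apply/eigenvalueP; exists (const_mx 1); last first.
  have /card_gt0P[y _] := card_vertices_gt0 diam_ge4.
  by apply/eqP => /rowP/(_ (enum_rank y)); rewrite !mxE => /eqP; rewrite oner_eq0.
apply/rowP => z; rewrite !mxE mulr1.
have /matrixP/(_ z z) := adjmx_mul_distfun drg_e bip_e diam_ge4 (fun=> 1 : C).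
rewrite !mxE gdistxx // mul0r addr0 mulr1 => <-; apply: eq_bigr => y _.
by rewrite !mxE mulrC (gdist_sym graph_e).
Qed.

(** Changing the signs of an eigenvector on one colour class. *)
Lemma opp_eigenvalue t : eigenvalue A t -> eigenvalue A (- t).
Proof.
have [Y bipY] := bip_e; case/eigenvalueP => u uA u_neq0.
pose s (j : 'I_#|X|) : C := (-1) ^+ (enum_val j \in Y).
apply/eigenvalueP; exists (\row_j (s j * u 0 j)); last first.
  apply: contraNneq u_neq0 => /rowP u0; apply/eqP/rowP => j.
  by have /eqP := u0 j; rewrite !mxE mulf_eq0 signr_eq0 => /eqP.
apply/rowP => z; rewrite !mxE mulNr mulrCA.
have /rowP/(_ z) := uA; rewrite !mxE => <-; rewrite mulr_sumr -sumrN.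
apply: eq_bigr => y _; rewrite !mxE /s; case: eqP => [|_]; last by rewrite !mulr0 oppr0.
move/eqP; rewrite (gdist_eq1 graph_e) => /bipY.
by do 2!case: (_ \in Y); move=> //= _; rewrite ?expr0 ?expr1 !mulr1 ?mulN1r ?mul1r ?opprK.
Qed.

(** For adjacent y and z, the squared norm of the projection of the difference
    of their unit vectors is 2 (f 0 - f 1), and k f 1 = theta_i f 0. *)
Lemma theta_le_valency i : (i <= D)%N -> theta i <= k.
Proof.
move=> le_i; have D_gt0 : (0 < D)%N by exact: leq_trans diam_ge4.
have [[y z] /= dyz] := gdist_attained graph_e (card_vertices_gt0 diam_ge4) D_gt0.
set f := idem_coef i; have f1 := eigen_f1 drg_e bip_e diam_ge4 (idem_eigen le_i).
have f0_gt0 := idem_coef0_gt0 le_i.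
have : 0 <= (f 0%N - f 1%N) *+ 2.
  have := sqnorm_ge0 (idem i *m (delta_mx (enum_rank y) 0 - delta_mx (enum_rank z) 0)).
  rewrite sqnorm_proj ?idem_herm ?idemM ?eqxx // mulmxBr -!colE.
  rewrite [(_ - _)^T]linearB /= map_mxB !trmx_delta !map_delta_mx mulmxBl -!rowE.
  rewrite idem_distfun // !mxE !enum_rankK !(gdistxx graph_e) (gdist_sym graph_e z) dyz.
  by rewrite -/f; congr (0 <= _); ring.
rewrite pmulrn_lge0 // => f01.
have: 0 <= k * (f 0%N - f 1%N) by rewrite mulr_ge0.
by rewrite mulrBr f1 -mulrBl pmulr_lge0 // subr_ge0.
Qed.

Lemma theta0 : theta 0 = k.
Proof.
have /theta_e.2[[|j] le_j kE] := valency_eigenvalue; first by rewrite kE.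
have := @theta_lt 0 j.+1; rewrite le_j -kE => /(_ isT)/lt_geF.
by rewrite theta_le_valency.
Qed.

(** Both j |-> - theta_j and j |-> theta_(D - j) list the spectrum in increasing
    order. *)
Lemma theta_sub i : (i <= D)%N -> theta (D - i) = - theta i.
Proof.
move=> le_i.
pose s1 := [seq - theta j | j <- iota 0 D.+1].
pose s2 := [seq theta (D - j) | j <- iota 0 D.+1].
have s12 : s1 = s2.
  apply: lt_sorted_eq.
  - rewrite sorted_map.
    apply: (sub_in_sorted _ (allss _) (iota_ltn_sorted 0 D.+1)) => j l.
    rewrite !mem_iota add0n /= => _ le_l lt_jl.
    by rewrite /relpre /= ltrN2 theta_lt // lt_jl.
  - rewrite sorted_map.
    apply: (sub_in_sorted _ (allss _) (iota_ltn_sorted 0 D.+1)) => j l.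
    rewrite !mem_iota add0n /= => _ le_l lt_jl.
    by rewrite /relpre /= theta_lt // leq_subr andbT ltn_sub2l // (leq_trans lt_jl).
  - have mem1 t : (t \in s1) = (eigenvalue A (- t)).
      apply/mapP/idP => [[j + ->]|/theta_e.2[j le_j tE]].
        by rewrite opprK mem_iota add0n => /andP[_]; apply: theta_eigenvalue.
      by exists j; rewrite ?mem_iota // -tE opprK.
    have mem2 t : (t \in s2) = (eigenvalue A t).
      apply/mapP/idP => [[j _ ->]|/theta_e.2[j le_j tE]].
        by rewrite theta_eigenvalue ?leq_subr.
      by exists (D - j)%N; rewrite ?mem_iota ?subKn // add0n ltnS leq_subr.
    move=> t; rewrite mem1 mem2; apply/idP/idP => /opp_eigenvalue //.
    by rewrite opprK.
have := congr1 (fun s => nth 0 s i) s12.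
by rewrite !(nth_map 0%N) ?size_iota // nth_iota // add0n => ->.
Qed.

End Spectrum.

(** * The local eigenvalue and the norms of the projections *)

Section LocalEigenvalue.
Local Open Scope sesquilinear_scope.
Variables (C : numClosedFieldType) (X : finType) (e : rel X) (theta : nat -> C).
Hypotheses (drg_e : distance_regular e) (bip_e : bipartite e).
Hypotheses (diam_ge4 : (4 <= diameter e)%N).
Hypothesis theta_e : eigenvalue_sequence e theta.

Let graph_e : connected_simple_graph e := drg_e.1.
Local Notation A := (adjmx C e).
Local Notation D := (diameter e).
Local Notation k := ((valency e)%:R : C).
Local Notation b i := ((bnum e i)%:R : C).
Local Notation M := (@distfun_mx C X e).
Local Notation f := (idem_coef e theta).
Local Notation Q := (idem e theta).

Let le_D h : (h <= 4)%N -> (h <= D)%N.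
Proof. by move/leq_trans; apply. Qed.

Let b_gt0 h : (h < 4)%N -> 0 < b h.
Proof. by move=> h4; rewrite ltr0n bnum_gt0 // le_D. Qed.

Lemma theta_le i j : (i <= j <= D)%N -> theta j <= theta i.
Proof.
case/andP; rewrite leq_eqVlt => /orP[/eqP->//|lt_ij] le_j.
by apply/ltW/(theta_lt theta_e); rewrite lt_ij.
Qed.

Lemma theta_sub_eq i : (i <= D)%N -> theta i = - theta (D - i).
Proof. by move=> le_i; rewrite (theta_sub drg_e bip_e theta_e le_i) opprK. Qed.

Lemma sqr_theta_eq i j : (i <= D)%N -> (j <= D)%N ->
  (theta i ^+ 2 == theta j ^+ 2) = (i == j) || (i == D - j)%N.
Proof.
move=> le_i le_j; rewrite eqf_sqr (theta_inj theta_e) //.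
by rewrite -(theta_sub drg_e bip_e theta_e le_j) (theta_inj theta_e) ?leq_subr.
Qed.

Lemma idem_coef_f2 i : (i <= D)%N ->
  k * b 1 * (f i 0%N - f i 2%N) = (k ^+ 2 - theta i ^+ 2) * f i 0%N.
Proof.
by move=> le_i; apply: (eigen_f2 drg_e bip_e diam_ge4); exact: idem_eigen.
Qed.

Lemma idem_coef_f4 i : (i <= D)%N ->
  b 2 * b 3 * (f i 2%N - f i 4%N) = (theta i ^+ 2 - b 2) * (f i 0%N - f i 2%N).
Proof.
by move=> le_i; apply: (eigen_f4 drg_e bip_e diam_ge4); exact: idem_eigen.
Qed.

(** The difference is a positive multiple of theta_0^2 - theta_i^2. *)
Lemma idem_coef02_eq0 i : (i <= D)%N ->
  (f i 0%N - f i 2%N == 0) = (i == 0%N) || (i == D).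
Proof.
move=> le_i; have kb_neq0 : k * b 1 != 0.
  by rewrite mulf_neq0 // gt_eqF // b_gt0.
have f0_gt0 := idem_coef0_gt0 drg_e bip_e diam_ge4 theta_e le_i.
rewrite -(inj_eq (mulfI kb_neq0)) mulr0 idem_coef_f2 //.
rewrite mulf_eq0 (gt_eqF f0_gt0) orbF subr_eq0 eq_sym.
rewrite -(theta0 drg_e bip_e diam_ge4 theta_e).
by rewrite sqr_theta_eq // subn0.
Qed.

Lemma idem_coef02_ge0 i : (i <= D)%N -> 0 <= f i 0%N - f i 2%N.
Proof.
move=> le_i; have kb_gt0 : 0 < k * b 1 by rewrite mulr_gt0 // b_gt0.
have f0_gt0 := idem_coef0_gt0 drg_e bip_e diam_ge4 theta_e le_i.
rewrite -(pmulr_rge0 _ kb_gt0) idem_coef_f2 // pmulr_lge0 // subr_sqr.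
rewrite -(theta0 drg_e bip_e diam_ge4 theta_e) mulr_ge0 // ?subr_ge0 ?theta_le //.
by rewrite (theta_sub_eq le_i) subr_ge0 theta_le ?leq_subr.
Qed.

(** Each term is b_2 b_3 (f_i(2) - f_i(4)), and the sum of all idempotents, being
    the identity, has zero entries at distances 2 and 4. *)
Lemma sum_idem_coef02 :
  \sum_(i < D.+1) (theta i ^+ 2 - b 2) * (f i 0%N - f i 2%N) = 0.
Proof.
under eq_bigr => i _ do rewrite -(idem_coef_f4 (leq_ord i)).
rewrite -mulr_sumr sumrB.
by rewrite !(sum_idem_coef drg_e bip_e diam_ge4 theta_e) ?subrr ?mulr0 ?le_D.
Qed.

(** If theta_n^2 were an extreme value of theta_i^2 for 0 < i < D and equal to
    b_2, all terms of the vanishing sum above would have the same sign, hence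
    be zero; so theta_1, theta_2 and theta_3 would have the same square. The
    sign of s selects the kind of extremum. *)
Lemma sqr_theta_neq_b2 (s : C) n : s != 0 ->
    (forall i, (0 < i < D)%N -> 0 <= s * (theta i ^+ 2 - theta n ^+ 2)) ->
  theta n ^+ 2 != b 2.
Proof.
move=> s_neq0 extremal; apply/eqP => tn_b2.
pose F i := s * ((theta i ^+ 2 - b 2) * (f i 0%N - f i 2%N)).
have F_ge0 i : (i <= D)%N -> 0 <= F i.
  move=> le_i; case: (boolP ((i == 0%N) || (i == D))) => [|]; rewrite /F.
    by rewrite -idem_coef02_eq0 // => /eqP->; rewrite !mulr0.
  rewrite negb_or -lt0n => /andP[i_gt0 neq_iD].
  rewrite mulrA mulr_ge0 ?idem_coef02_ge0 // -tn_b2 extremal // i_gt0.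
  by rewrite ltn_neqAle neq_iD.
have sumF : \sum_(i < D.+1) F i = 0 by rewrite -mulr_sumr sum_idem_coef02 mulr0.
have sqr_b2 i : (0 < i < D)%N -> theta i ^+ 2 = b 2.
  case/andP=> i_gt0 lt_i; apply/eqP; rewrite -subr_eq0.
  have lt_i' : (i < D.+1)%N by exact: ltnW.
  have /eqP := psumr_eq0P (fun (j : 'I_D.+1) _ => F_ge0 j (leq_ord j)) sumF
    (i := Ordinal lt_i') isT.
  rewrite /F /= !mulf_eq0 (negPf s_neq0) idem_coef02_eq0 1?ltnW //.
  by rewrite (gtn_eqF i_gt0) (ltn_eqF lt_i) !orbF.
have [lt1 lt2 lt3] : [/\ 1 < D, 2 < D & 3 < D]%N.
  by split=> //; apply: leq_trans diam_ge4.
(* A square is shared by the indices i and D - i only. *)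
have := sqr_theta_eq (ltnW lt2) (ltnW lt1); rewrite !sqr_b2 //= eqxx => /esym/eqP eq2.
have := sqr_theta_eq (ltnW lt3) (ltnW lt1); rewrite !sqr_b2 //= eqxx => /esym/eqP eq3.
by move: eq3; rewrite -eq2.
Qed.

Lemma sqr_theta1_neq_b2 : theta 1 ^+ 2 != b 2.
Proof.
apply: (@sqr_theta_neq_b2 (-1)) => [|i /andP[i_gt0 lt_i]].
  by rewrite oppr_eq0 oner_eq0.
have D_gt0 := leq_ltn_trans (leq0n _) lt_i.
rewrite mulN1r opprB subr_sqr mulr_ge0 ?subr_ge0 ?theta_le ?i_gt0 1?ltnW //.
rewrite -[X in _ + X]opprK subr_ge0 -(theta_sub drg_e bip_e theta_e) 1?ltnW //.
by rewrite theta_le // subn_gt0 lt_i leq_subr.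
Qed.

Lemma sqr_theta_half_neq_b2 : odd D -> theta D./2 ^+ 2 != b 2.
Proof.
move=> odd_D; set d := D./2.
have D2 : D = (d + d.+1)%N by rewrite addnS addnn -[LHS]odd_double_half odd_D.
have Dd : (D - d)%N = d.+1 by rewrite D2 addKn.
have le_d : (d <= D)%N by rewrite D2 leq_addr.
have le_d1 : (d.+1 <= D)%N by rewrite D2 leq_addl.
apply: (@sqr_theta_neq_b2 1) => [|i /andP[i_gt0 lt_i]]; first exact: oner_neq0.
rewrite mul1r subr_sqr.
have -> : theta i + theta d = theta i - theta d.+1.
  by rewrite (theta_sub_eq le_d) Dd.
have [le_id|lt_di] := leqP i d.
  by rewrite mulr_ge0 // subr_ge0 theta_le // ?le_id ?(leqW le_id).
by rewrite mulr_le0 // subr_le0 theta_le // ?lt_di ?(ltnW lt_di) // ltnW.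
Qed.

Section NormFormula.
Variables (x : X) (v : 'cV[C]_#|X|) (eta : C).
Local Notation E2 := (dual_idempotent C e x 2).
Hypothesis E2v : E2 *m v = v.
Hypothesis E0v : dual_idempotent C e x 0 *m (A *m (A *m v)) = 0.
Hypothesis local_v : E2 *m distmx C e 2 *m E2 *m v = eta *: v.

Lemma dual_idempotentE i (w : 'cV[C]_#|X|) y :
  (dual_idempotent C e x i *m w) y 0 = (gdist e x (enum_val y) == i)%:R * w y 0 :> C.
Proof. by rewrite /dual_idempotent mul_diag_mx !mxE. Qed.

(** The entry at x of A^2 v is c_2 times the sum of the entries of v, as v
    lives on the sphere of radius 2. *)
Lemma sum_endpoint2 : \sum_z v z 0 = 0.
Proof.
have c2_neq0 : (cnum e 2)%:R != 0 :> C.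
  by rewrite pnatr_eq0 -lt0n cnum_gt0 // le_D.
apply/eqP; rewrite -(inj_eq (mulfI c2_neq0)) mulr0 mulr_sumr.
have := dual_idempotentE 0 (A *m (A *m v)) (enum_rank x).
rewrite E0v mxE enum_rankK gdistxx // mul1r mulmxA adjmx_distfun.
rewrite (adjmx_mul_distfun drg_e bip_e diam_ge4) mxE => sum0.
rewrite [X in _ == X]sum0; apply/eqP/eq_bigr => z _.
rewrite mxE enum_rankK -E2v dual_idempotentE.
by case: eqP => [->|_]; rewrite ?mul0r ?mulr0 //= !(mulr0n, mulr1n, mulr0, mulr1, add0r).
Qed.

(** Two vertices of the sphere of radius 2 are at distance 0, 2 or 4. On
    vectors supported there, A_4 can be traded for the all-one matrix, which
    annihilates v, minus the identity and A_2, whose restrictions to the sphere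
    act on v by scalars. *)
Lemma endpoint2_quadratic g : E2 *m (M g *m v) =
  (g 0%N - g 2%N + (g 2%N - g 4%N) * (1 + eta)) *: v.
Proof.
have -> : (g 0%N - g 2%N + (g 2%N - g 4%N) * (1 + eta)) *: v
  = (g 0%N - g 4%N) *: v + (g 2%N - g 4%N) *: (eta *: v).
  by rewrite scalerA -scalerDl; congr (_ *: _); ring.
rewrite -local_v -!mulmxA E2v; apply/colP => y.
have linE a c (u w : 'cV[C]_#|X|) : (a *: u + c *: w) y 0 = a * u y 0 + c * w y 0.
  by rewrite !mxE.
have vE : v y 0 = (gdist e x (enum_val y) == 2%N)%:R * v y 0.
  by rewrite -dual_idempotentE E2v.
rewrite linE vE !dual_idempotentE [in LHS]mxE [(distmx C e 2 *m v) y 0]mxE.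
case: eqP => [dxy|_]; last by rewrite !(mul0r, mulr0) addr0.
rewrite !mul1r.
have {1}-> : v y 0 = \sum_z (y == z)%:R * v z 0.
  rewrite (bigD1 y) //= eqxx mul1r big1 ?addr0 // => z /negPf.
  by rewrite eq_sym => ->; rewrite mul0r.
have zero4 : g 4%N * \sum_z v z 0 = 0 by rewrite sum_endpoint2 mulr0.
rewrite -[RHS]addr0 -[X in _ = _ + X]zero4 !mulr_sumr -!big_split /=.
apply: eq_bigr => z _; rewrite !mxE -E2v dual_idempotentE.
case: eqP => [dxz|_]; last by rewrite !(mul0r, mulr0) !addr0.
rewrite mul1r -(inj_eq enum_val_inj) -(gdist_eq0 graph_e).
have: (gdist e (enum_val y) (enum_val z) <= 4)%N.
  have := gdist_triangle graph_e (enum_val y) x (enum_val z).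
  by rewrite (gdist_sym graph_e _ x) dxy dxz.
have: ~~ odd (gdist e (enum_val y) (enum_val z)).
  have [Y bipY] := bip_e; have oddE := odd_gdist graph_e bipY.
  have := oddE x (enum_val y); have := oddE x (enum_val z); rewrite dxy dxz oddE /=.
  by do 3!case: (_ \in Y).
by move: (gdist e _ _) => [|[|[|[|[|//]]]]] //= _ _; ring.
Qed.

Lemma sqnorm_idem_endpoint2 i : (i <= D)%N ->
  sqnorm (Q i *m v) =
  (f i 0%N - f i 2%N + (f i 2%N - f i 4%N) * (1 + eta)) * sqnorm v.
Proof.
move=> le_i; rewrite sqnorm_proj ?idem_herm ?(idemM theta_e) ?eqxx //.
have E2h : E2^t* = E2.
  rewrite /dual_idempotent tr_diag_mx map_diag_mx; congr diag_mx.
  by apply/rowP => y; rewrite !mxE; exact: conjC_nat.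
rewrite -{1}E2v trmx_mul map_mxM E2h -mulmxA.
rewrite (idem_distfun drg_e bip_e diam_ge4 theta_e le_i).
by rewrite endpoint2_quadratic -scalemxAr mxE.
Qed.

(** With the value of eta, the factor in the norm formula becomes a multiple of
    (f 0 - f 2) (theta_n^2 - theta_i^2): the first factor vanishes for i = 0
    and i = D, the second one for i = n and i = D - n. *)
Lemma idem_endpoint2_eq0 i n : (i <= D)%N -> (n <= D)%N -> v != 0 ->
    theta n ^+ 2 != b 2 -> eta = - 1 - (b 2 * b 3) / (theta n ^+ 2 - b 2) ->
  (Q i *m v == 0) = (i \in [:: 0; n; D - n; D]%N).
Proof.
move=> le_i le_n v_neq0 tn_neq etaE.
have sqv_neq0 : sqnorm v != 0 by rewrite sqnorm_eq0.
rewrite -sqnorm_eq0 sqnorm_idem_endpoint2 // mulf_eq0 (negPf sqv_neq0).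
have tn : theta n ^+ 2 - b 2 != 0 by rewrite subr_eq0.
have -> : f i 0%N - f i 2%N + (f i 2%N - f i 4%N) * (1 + eta)
  = (f i 0%N - f i 2%N) * ((theta n ^+ 2 - theta i ^+ 2) / (theta n ^+ 2 - b 2)).
  rewrite etaE; have -> : 1 + (- 1 - b 2 * b 3 / (theta n ^+ 2 - b 2))
    = - (b 2 * b 3 / (theta n ^+ 2 - b 2)) by ring.
  transitivity (f i 0%N - f i 2%N
      - b 2 * b 3 * (f i 2%N - f i 4%N) / (theta n ^+ 2 - b 2)); first by field.
  by rewrite idem_coef_f4 //; field.
rewrite orbF mulf_eq0 idem_coef02_eq0 // mulf_eq0 invr_eq0 (negPf tn) orbF.
rewrite subr_eq0 [theta n ^+ 2 == _]eq_sym sqr_theta_eq // !inE.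
by do 4!case: (_ == _).
Qed.

End NormFormula.
End LocalEigenvalue.

(** * Thin irreducible modules with endpoint two *)

Section MatrixImage.
Variables (C : fieldType) (m : nat).
Implicit Types (B : 'M[C]_m) (W U : {vspace 'cV[C]_m}).

Lemma mximageP B W u :
  reflect (exists2 w, w \in W & u = B *m w) (u \in mximage B W).
Proof.
by apply: (iffP memv_imgP) => -[w Ww ->]; exists w; rewrite ?lfunE.
Qed.

Lemma mem_mximage B W w : w \in W -> B *m w \in mximage B W.
Proof. by move=> Ww; apply/mximageP; exists w. Qed.

Lemma mximage_subP B W U :
  reflect (forall w, w \in W -> B *m w \in U) (mximage B W <= U)%VS.
Proof.
apply: (iffP subvP) => [sWU w Ww|sWU _ /mximageP[w Ww ->]]; last exact: sWU.
exact/sWU/mem_mximage.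
Qed.

Lemma mximage_eq0P B W :
  reflect (forall w, w \in W -> B *m w = 0) (mximage B W == 0%VS).
Proof.
rewrite -subv0; apply: (iffP (mximage_subP _ _ _)) => BW w /BW.
  by rewrite memv0 => /eqP.
by move->; rewrite mem0v.
Qed.

Lemma mximage_nonzero B W : mximage B W != 0%VS ->
  exists2 w, w \in W & B *m w != 0.
Proof.
rewrite -vpick0 => nz; have /mximageP[w Ww eq_w] := memv_pick (mximage B W).
by exists w; rewrite -?eq_w.
Qed.

(** The images are the summands of a direct sum decomposition of W. *)
Lemma dim_mximage_idempotents r (P : nat -> 'M[C]_m) W :
    (forall i j, (i < r)%N -> (j < r)%N -> P i *m P j = if i == j then P i else 0) ->
    \sum_(i < r) P i = 1%:M ->
    (forall i, (i < r)%N -> (mximage (P i) W <= W)%VS) ->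
  \dim W = (\sum_(i < r) \dim (mximage (P i) W))%N.
Proof.
move=> PM sumP PW.
have defW : W = (\sum_(i < r) mximage (P i) W)%VS.
  apply/eqP; rewrite eqEsubv; apply/andP; split; last first.
    by apply/subv_sumP => i _; exact: PW.
  apply/subvP => w Ww; rewrite -[w]mul1mx -sumP mulmx_suml.
  by apply: memv_sumr => i _; exact: mem_mximage.
rewrite [in LHS]defW; apply/directvP/directv_sum_independent => us us_W sum0 i _.
have PU (j : 'I_r) : P i *m us j = if j == i then us i else 0.
  have /mximageP[w _ usE] := us_W j isT.
  rewrite usE mulmxA PM // (inj_eq val_inj) eq_sym.
  by case: (eqVneq j i) => [<-|_]; rewrite ?mul0mx.
have := congr1 (mulmx (P i)) sum0.
rewrite mulmx0 mulmx_sumr (bigD1 i) //= PU eqxx big1 ?addr0 // => j ne_ji.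
by rewrite PU (negPf ne_ji).
Qed.

End MatrixImage.

Section DualIdempotents.
Variables (C : numClosedFieldType) (X : finType) (e : rel X) (x : X).
Hypothesis graph_e : connected_simple_graph e.
Local Notation A := (adjmx C e).
Local Notation E := (dual_idempotent C e x).
Local Notation D := (diameter e).
Local Notation dist y := (gdist e x (enum_val y)).

(** The projection onto the functions supported on the ball of radius j. *)
Definition ball_idempotent j : 'M[C]_#|X| := \sum_(i < j.+1) E i.
Local Notation F := ball_idempotent.

Lemma dual_idempotentM i j : E i *m E j = if i == j then E i else 0.
Proof.
rewrite /dual_idempotent mulmx_diag; case: (eqVneq i j) => [<-|ne_ij].
  by congr diag_mx; apply/rowP => y; rewrite !mxE; case: eqP; rewrite ?mulr1 ?mulr0.
apply/matrixP => y z; rewrite !mxE; case: (dist y =P i) => [->|_].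
  by rewrite (negPf ne_ij) mulr0 mul0rn.
by rewrite mul0r mul0rn.
Qed.

Lemma ball_idempotentE j (w : 'cV[C]_#|X|) y :
  (F j *m w) y 0 = (dist y <= j)%N%:R * w y 0.
Proof.
rewrite mulmx_suml summxE; under eq_bigr => i _ do rewrite dual_idempotentE.
have [le_j|lt_j] := leqP (dist y) j.
  rewrite (bigD1 (Ordinal (le_j : dist y < j.+1)%N)) //= eqxx big1 ?addr0 // => i.
  by rewrite -(inj_eq val_inj) eq_sym /= => /negPf->; rewrite mul0r.
rewrite big1 ?mul0r // => i _.
by rewrite (gtn_eqF (leq_trans (ltn_ord i) lt_j)) mul0r.
Qed.

Lemma mul_ball_idempotent_diameter (w : 'cV[C]_#|X|) : F D *m w = w.
Proof.
by apply/colP => y; rewrite ball_idempotentE gdist_le_diameter mul1r.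
Qed.

Lemma ball_idempotent_diameter : F D = 1%:M.
Proof.
apply/matrixP => y z; have := mul_ball_idempotent_diameter (delta_mx z 0).
by rewrite -colE => /colP/(_ y); rewrite [LHS]mxE => ->; rewrite !mxE eqxx andbT.
Qed.

Lemma ball_idempotentS j : F j.+1 = F j + E j.+1.
Proof. by rewrite /F big_ord_recr. Qed.

Lemma ball_idempotent_comm i j : E i *m F j = F j *m E i.
Proof.
rewrite mulmx_sumr mulmx_suml; apply: eq_bigr => l _.
by rewrite !dual_idempotentM eq_sym; case: eqP => // ->.
Qed.

Lemma ball_idempotent_dual j : F j *m E j = E j.
Proof.
rewrite mulmx_suml (bigD1 ord_max) //= dual_idempotentM eqxx big1 ?addr0 // => l.
by rewrite dual_idempotentM -(inj_eq val_inj) /= => /negPf->.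
Qed.

(** Outside the ball of radius j, A only sees what it raises from the sphere of
    radius j to that of radius j + 1. *)
Lemma adjmx_ball_idempotent j (w : 'cV[C]_#|X|) :
  A *m (F j *m w) = F j *m (A *m (F j *m w)) + E j.+1 *m (A *m (E j *m w)).
Proof.
have AE (u : 'cV[C]_#|X|) y :
    (A *m u) y 0 = \sum_z (gdist e (enum_val y) (enum_val z) == 1%N)%:R * u z 0.
  by rewrite mxE; apply: eq_bigr => z _; rewrite mxE.
apply/colP => y; rewrite [RHS]mxE ball_idempotentE dual_idempotentE !AE.
have [le_j|lt_j] := leqP (dist y) j.
  by rewrite mul1r (ltn_eqF (le_j : dist y < j.+1)%N) mul0r addr0.
rewrite mul0r add0r mulr_sumr; apply: eq_bigr => z _.
rewrite ball_idempotentE dual_idempotentE.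
case yz: (_ == 1%N); last by rewrite !mul0r mulr0.
rewrite (gdist_eq1 graph_e) in yz; have := gdist_leS graph_e x yz.
rewrite !(gdist_sym graph_e _ x) => le_yz.
have [le_z|lt_z] := leqP (dist z) j; last first.
  by rewrite (gtn_eqF lt_z) !(mul0r, mulr0).
have eq_z : dist z = j by apply/eqP; rewrite eqn_leq le_z -ltnS (leq_trans lt_j).
rewrite eq_z eqxx (_ : dist y == j.+1) ?mul1r //.
by rewrite eqn_leq lt_j andbT -eq_z.
Qed.

End DualIdempotents.

Section Module.
Variables (C : numClosedFieldType) (X : finType) (e : rel X) (x : X).
Hypothesis graph_e : connected_simple_graph e.
Variable W : {vspace 'cV[C]_#|X|}.
Local Notation A := (adjmx C e).
Local Notation E := (dual_idempotent C e x).
Local Notation F := (ball_idempotent C e x).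
Local Notation D := (diameter e).
Hypotheses (irrW : irreducible_tmodule e x W) (thinW : thin e x W).
Hypothesis endW : endpoint e x W = 2%N.
Hypothesis diam_ge4 : (4 <= D)%N.

Lemma tmodule_stable (U : {vspace 'cV[C]_#|X|}) :
    (forall w, w \in U -> A *m w \in U) ->
    (forall i w, (i <= D)%N -> w \in U -> E i *m w \in U) ->
  tmodule e x U.
Proof.
move=> AU EU B; elim=> {B} [B [->|[i le_i ->]]|a|B1 B2 _ B1U _ B2U|B1 B2 _ B1U _ B2U].
- exact/mximage_subP.
- by apply/mximage_subP => w; exact: EU.
- by apply/mximage_subP => w Uw; rewrite mul_scalar_mx memvZ.
- apply/mximage_subP => w Uw; rewrite mulmxDl memvD //.
    exact: (mximage_subP _ _ _ B1U).
  exact: (mximage_subP _ _ _ B2U).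
- apply/mximage_subP => w Uw; rewrite -mulmxA.
  by apply: (mximage_subP _ _ _ B1U); exact: (mximage_subP _ _ _ B2U).
Qed.

Lemma adjmx_stable w : w \in W -> A *m w \in W.
Proof.
case: irrW => modW _ _; move: w; apply/mximage_subP/modW.
by apply: gen_mem; left.
Qed.

Lemma dual_idempotent_stable i w : (i <= D)%N -> w \in W -> E i *m w \in W.
Proof.
case: irrW => modW _ _ le_i; move: w; apply/mximage_subP/modW.
by apply: gen_mem; right; exists i.
Qed.

Lemma ball_idempotent_stable j w : (j <= D)%N -> w \in W -> F j *m w \in W.
Proof.
move=> le_j Ww; rewrite mulmx_suml; apply: memv_suml => i _.
by apply: dual_idempotent_stable => //; apply: leq_trans le_j; exact: leq_ord.
Qed.

Lemma endpoint2P : [/\ mximage (E 0) W = 0%VS, mximage (E 1) W = 0%VS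
  & mximage (E 2) W <> 0%VS].
Proof.
have lt_end : (endpoint e x W < D.+1)%N by rewrite endW ltnS; apply: leq_trans diam_ge4.
have before i : (i < 2)%N -> mximage (E i) W = 0%VS.
  rewrite -endW => lt_i; have := before_find 0%N lt_i.
  by rewrite nth_iota ?(ltn_trans lt_i) // => /negbFE/eqP.
split; [exact: before | exact: before | apply/eqP].
have has_end : has (fun i => mximage (E i) W != 0%VS) (iota 0 D.+1).
  by rewrite has_find size_iota.
have := nth_find 0%N has_end; rewrite -[find _ _]/(endpoint e x W).
by rewrite nth_iota // endW.
Qed.

(** If A raises nothing from the sphere of radius j, the part of W in the ball
    of radius j is a submodule, nonzero as it contains E*_2 W, hence all of W. *)
Lemma raising_stop j : (2 <= j <= D)%N ->
    (forall w, w \in W -> E j.+1 *m (A *m (E j *m w)) = 0) ->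
  forall i, (j < i <= D)%N -> mximage (E i) W = 0%VS.
Proof.
case/andP=> j_ge2 le_j stop i /andP[lt_ji le_i].
have [_ _ minW] := irrW; have [_ _ E2W] := endpoint2P.
pose U := mximage (F j) W.
have U_W : (U <= W)%VS by apply/mximage_subP => w; exact: ball_idempotent_stable.
have : tmodule e x U.
  apply: tmodule_stable => [u|l u le_l] /mximageP[w Ww ->].
    rewrite adjmx_ball_idempotent // stop // addr0.
    by apply/mem_mximage/adjmx_stable/(subvP U_W)/mem_mximage.
  rewrite mulmxA ball_idempotent_comm -mulmxA.
  by apply/mem_mximage/dual_idempotent_stable.
case/minW=> // [U0|UW].
  case: E2W; apply/eqP/mximage_eq0P => w Ww.
  have /eqP/mximage_eq0P/(_ _ Ww) Fw0 := U0.
  apply/colP => y; rewrite dual_idempotentE.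
  have /colP/(_ y) := Fw0; rewrite ball_idempotentE !mxE.
  by case: eqP => [->|_]; rewrite ?mul0r // j_ge2.
apply/eqP/mximage_eq0P => w; rewrite -UW => /mximageP[u Uu ->].
apply/colP => y; rewrite dual_idempotentE ball_idempotentE mxE.
by case: eqP => [->|_]; rewrite ?mul0r // leqNgt lt_ji mul0r mulr0.
Qed.

(** The parts of W in balls of increasing radius j lie in U, by induction on j.
    Either A raises nothing from the sphere of radius j and W has no component
    outside the ball, or the line E*_(j+1) W is spanned by a raised vector,
    that is, by the image under A of an element of U, up to a component in
    the ball of radius j. *)
Lemma generated_by_endpoint_vector (v : 'cV[C]_#|X|) (U : {vspace 'cV[C]_#|X|}) :
    v \in mximage (E 2) W -> v != 0 -> v \in U ->
    (forall u, u \in U -> A *m u \in U) ->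
  (W <= U)%VS.
Proof.
move=> Wv v_neq0 Uv AU; have [E0W E1W _] := endpoint2P.
have line i u w : (i <= D)%N -> u \in mximage (E i) W -> w \in mximage (E i) W ->
    u != 0 -> w \in <[u]>%VS.
  move=> le_i Wu Ww u_neq0; suff -> : (<[u]> = mximage (E i) W)%VS by [].
  apply/eqP; rewrite eqEdim -memvE Wu dim_vline u_neq0; exact: thinW.
have ball_U j : (2 <= j <= D)%N -> forall w, w \in W -> F j *m w \in U.
  elim: j => // -[|[|j]] // IHj /andP[_ le_j] w Ww; rewrite ball_idempotentS mulmxDl.
    rewrite ball_idempotentS mulmxDl /F big_ord1.
    have -> : E 0 *m w = 0 by apply/mximage_eq0P: Ww; rewrite E0W.
    have -> : E 1 *m w = 0 by apply/mximage_eq0P: Ww; rewrite E1W.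
    have le2 : (2 <= D)%N by apply: leq_trans diam_ge4.
    rewrite !add0r; have /vlineP[c ->] := line _ _ _ le2 Wv (mem_mximage _ Ww) v_neq0.
    exact: memvZ.
  have le_j' : (2 <= j.+2 <= D)%N := ltnW le_j.
  rewrite memvD ?IHj //.
  have [/mximage_eq0P stop|] := boolP (mximage (E j.+3 *m A *m E j.+2) W == 0%VS).
    have -> : E j.+3 *m w = 0; last by rewrite mem0v.
    suff: mximage (E j.+3) W == 0%VS by move/mximage_eq0P; apply.
    rewrite (raising_stop le_j') // => [u Wu|]; last by rewrite leqnn.
    by rewrite !mulmxA stop.
  case/mximage_nonzero=> u Wu; rewrite -!mulmxA => Eu_neq0.
  have Eu : E j.+3 *m (A *m (E j.+2 *m u)) \in U.
    have := adjmx_ball_idempotent x graph_e j.+2 (E j.+2 *m u).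
    rewrite [F j.+2 *m (E _ *m u)]mulmxA ball_idempotent_dual.
    rewrite [E j.+2 *m (E _ *m u)]mulmxA dual_idempotentM eqxx.
    move=> /esym/(canRL (addKr _)) ->.
    have E_W : E j.+2 *m u \in W by apply: dual_idempotent_stable => //; exact: ltnW.
    have E_U : E j.+2 *m u \in U.
      have := IHj le_j' _ E_W.
      by rewrite mulmxA ball_idempotent_dual.
    by rewrite memvD ?AU // memvN IHj // adjmx_stable.
  have /vlineP[c ->] : E j.+3 *m w \in <[E j.+3 *m (A *m (E j.+2 *m u))]>%VS.
    apply: (line _ _ _ le_j) Eu_neq0; rewrite mem_mximage // adjmx_stable //.
    by apply: dual_idempotent_stable => //; exact: ltnW.
  exact: memvZ.
apply/subvP => w Ww; rewrite -(mul_ball_idempotent_diameter e x w).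
by apply: ball_U => //; rewrite leqnn andbT; apply: leq_trans diam_ge4.
Qed.

End Module.

(** * Counting the nonzero components *)

Lemma sum_notin (D : nat) (s : seq nat) : uniq s -> {in s, forall i, (i <= D)%N} ->
  (\sum_(i < D.+1) ((i : nat) \notin s))%N = (D.+1 - size s)%N.
Proof.
move=> uniq_s s_le; rewrite -(big_mkord xpredT (fun i => (i \notin s) : nat)).
have <- : (count (mem s) (index_iota 0 D.+1) = size s)%N.
  rewrite -size_filter; apply: perm_size; apply: uniq_perm => //.
    by rewrite filter_uniq ?iota_uniq.
  move=> i; rewrite mem_filter /= mem_index_iota /= ltnS.
  by case: (boolP (i \in s)) => // /s_le ->.
rewrite -big_mkcond sum1_count.
have size_D : size (index_iota 0 D.+1) = D.+1 by rewrite size_iota subn0.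
by rewrite -[X in (X - _)%N]size_D -(count_predC (mem s)) addKn.
Qed.

(** A zero at some i between 2 and D - 2 would leave at most the i - 2 < D - 3
    nonzero values at 2, ..., i - 1. So all the D - 3 values in that range are
    1, and nothing is left for D - 1 and D. *)
Lemma contiguous_support (D : nat) (g : nat -> nat) : (4 <= D)%N ->
    g 0 = 0%N -> g 1 = 0%N -> (forall i, (i <= D)%N -> (g i <= 1)%N) ->
    (forall j i, (2 <= j)%N -> (j < i <= D)%N -> g j = 0%N -> g i = 0%N) ->
    (\sum_(i < D.+1) g i)%N = (D - 3)%N ->
  forall i, (i <= D)%N -> g i = (i \notin [:: 0; 1; D - 1; D]%N).
Proof.
move=> D_ge4 g0 g1 g_le gap; rewrite -(big_mkord xpredT g) => sum_g.
have sum_le j : (2 <= j <= D.+1)%N -> (\sum_(0 <= i < j) g i <= j - 2)%N.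
  case/andP=> j_ge2 le_j; rewrite (big_cat_nat (leq0n 2) j_ge2) /=.
  rewrite big_nat_recl // big_nat1 g0 g1 add0n.
  rewrite -[leqRHS]muln1 -sum_nat_const_nat !big_nat leq_sum // => i /andP[_ lt_i].
  by apply: g_le; rewrite -ltnS (leq_trans lt_i).
have pos i : (2 <= i <= D - 2)%N -> g i = 1%N.
  case/andP=> i_ge2 le_i; have lt_iD : (i < D.+1)%N by lia.
  apply/eqP; rewrite eqn_leq g_le // lt0n; apply/eqP => gi0.
  have tail0 : (\sum_(i <= j < D.+1) g j = 0)%N.
    rewrite big_nat big1 // => j.
    rewrite leq_eqVlt ltnS => /andP[/orP[/eqP<-//|lt_ij] le_j].
    by apply: gap gi0; rewrite ?lt_ij.
  have := sum_le i; rewrite i_ge2 ltnW // => /(_ isT).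
  have := sum_g; rewrite (big_cat_nat (leq0n i) (ltnW lt_iD)) /= tail0; lia.
have last0 : (g (D - 1) + g D = 0)%N.
  have sum_mid : (\sum_(2 <= i < D - 1) g i = D - 3)%N.
    rewrite (@eq_big_nat _ _ _ _ _ _ (fun=> 1%N)).
      by rewrite sum_nat_const_nat; lia.
    by move=> i lt_i; apply: pos; lia.
  have := sum_g; rewrite (big_cat_nat (leq0n 2)) /=; last by lia.
  rewrite (@big_cat_nat _ _ _ (D - 1) 2) /=; [|lia|lia].
  rewrite sum_mid [X in (_ + (_ + X))%N]big_ltn; last by lia.
  rewrite [X in (_ + (_ + (_ + X)))%N]big_ltn; last by lia.
  rewrite [X in (_ + (_ + (_ + (_ + X))))%N]big_geq; last by lia.
  have -> : (D - 1).+1 = D by lia.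
  by lia.
move=> i le_i; rewrite !inE; have [i_ge2|] := leqP 2 i; last first.
  by case: i {le_i} => [|[|//]] _; rewrite ?g0 ?g1.
have [le_i2|lt_i2] := leqP i (D - 2); first by rewrite pos ?i_ge2 //; lia.
have : i = (D - 1)%N \/ i = D by lia.
by case=> ->; lia.
Qed.

Theorem theorem13p7 (C : numClosedFieldType) (X : finType) (e : rel X)
    (D d : nat) (theta : nat -> C) (x : X) (n : nat)
    (W : {vspace 'cV[C]_#|X|}) :
  distance_regular e ->
  bipartite e ->
  diameter e = D ->
  (4 <= D)%N ->
  (3 <= valency e)%N ->
  eigenvalue_sequence e theta ->
  d = D./2 ->
  (if odd D then n = 1%N \/ n = d else n = 1%N) ->
  irreducible_tmodule e x W ->
  thin e x W ->
  endpoint e x W = 2%N ->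
  has_local_eigenvalue e x W
    (- 1 - (bnum e 2 * bnum e 3)%:R / (theta n ^+ 2 - (bnum e 2)%:R)) ->
  [/\ \dim W = (D - 3)%N,
      forall i : nat, (i <= D)%N ->
        if i \in [:: 0; 1; D - 1; D]%N
        then mximage (dual_idempotent C e x i) W = 0%VS
        else \dim (mximage (dual_idempotent C e x i) W) = 1%N
    & forall i : nat, (i <= D)%N ->
        if i \in [:: 0; n; D - n; D]%N
        then mximage (primitive_idempotent e (theta i)) W = 0%VS
        else \dim (mximage (primitive_idempotent e (theta i)) W) = 1%N].
Proof.
move=> drg bip <-{D} D_ge4 _ theta_e def_d def_n irrW thinW endW; subst d.
set D := diameter e in D_ge4 def_n *.
set eta := - 1 - _ => local_eta.
have [graph_e _] := drg.
have n_range : (0 < n)%N && (n.*2 < D)%N.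
  have odd_D := odd_double_half D.
  by move: def_n; case: (odd D) odd_D => /= odd_D => [[]|] ->; lia.
have tn_neq : theta n ^+ 2 != (bnum e 2)%:R.
  move: def_n; have neq1 := sqr_theta1_neq_b2 drg bip D_ge4 theta_e.
  case: ifP => [odd_D [|]|_] -> //.
  exact: (sqr_theta_half_neq_b2 drg bip D_ge4 theta_e).
have [E0W E1W /eqP E2W] := endpoint2P endW D_ge4.
have [w Ww E2w] := mximage_nonzero E2W.
pose v := dual_idempotent C e x 2 *m w.
have Wv : v \in mximage (dual_idempotent C e x 2) W by exact: mem_mximage.
have E2v : dual_idempotent C e x 2 *m v = v by rewrite mulmxA dual_idempotentM eqxx.
have vW : v \in W by apply: (dual_idempotent_stable irrW) => //; apply: leq_trans D_ge4.
have E0v : dual_idempotent C e x 0 *m (adjmx C e *m (adjmx C e *m v)) = 0.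
  have /eqP/mximage_eq0P := E0W; apply.
  by do 2!apply: (adjmx_stable irrW).
have idem_v i : (i <= D)%N -> (idem e theta i *m v == 0) = (i \in [:: 0; n; D - n; D]%N).
  move=> le_i; have eq0 := idem_endpoint2_eq0 drg bip D_ge4 theta_e E2v E0v (local_eta v Wv).
  apply: eq0 => //.
    by lia.
  by rewrite /eta natrM.
have idemW i : (i <= D)%N -> (mximage (idem e theta i) W <= W)%VS.
  move=> le_i; apply/mximage_subP.
  apply: (idem_ind drg theta_e (K := fun B => forall u, u \in W -> B *m u \in W)) => //.
    by move=> u _; rewrite mul0mx mem0v.
  move=> B c BW u Wu; rewrite mulmxDl mul_scalar_mx memvD ?memvZ // -mulmxA.
  by apply: (adjmx_stable irrW); exact: BW.
(* The vectors that Q_i maps into the line of Q_i v form an A-invariant space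
   containing v, hence containing W. *)
have idem_line i : (i <= D)%N -> mximage (idem e theta i) W = <[idem e theta i *m v]>%VS.
  move=> le_i; apply/eqP; rewrite eqEsubv -memvE mem_mximage // andbT.
  apply/mximage_subP => u Wu.
  pose U := (linfun (mulmx (idem e theta i)) @^-1: <[idem e theta i *m v]>)%VS.
  suff /subvP/(_ u Wu) : (W <= U)%VS by rewrite -memv_preim lfunE.
  apply: (generated_by_endpoint_vector graph_e irrW thinW endW D_ge4 Wv E2w) => [|a].
    by rewrite -memv_preim lfunE memv_line.
  rewrite -!memv_preim !lfunE /= [_ *m (adjmx C e *m _)]mulmxA idem_adjmx //.
  by rewrite -scalemxAl; exact: memvZ.
have dim_idem i : (i <= D)%N ->
    \dim (mximage (idem e theta i) W) = (i \notin [:: 0; n; D - n; D]%N).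
  by move=> le_i; rewrite idem_line // dim_vline idem_v.
have dimW : \dim W = (D - 3)%N.
  rewrite (dim_mximage_idempotents (r := D.+1) (P := idem e theta)).
  - under eq_bigr => i _ do rewrite dim_idem ?leq_ord //.
    have uniq_s : uniq [:: 0; n; D - n; D]%N by rewrite /= !inE; lia.
    rewrite sum_notin // => i.
    by rewrite !inE => /or4P[] /eqP->; lia.
  - by move=> i j; exact: idemM.
  - exact: (idem_sum1 drg theta_e).
  - by move=> i; exact: idemW.
have from_dim (U : {vspace 'cV[C]_#|X|}) (c : bool) : \dim U = (~~ c) ->
    if c then U = 0%VS else \dim U = 1%N.
  by case: c => //= /eqP; rewrite dimv_eq0 => /eqP.
split=> // i le_i; apply: from_dim; last first.
  by rewrite (primitive_idempotent_idem drg bip D_ge4 theta_e le_i) dim_idem.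
pose g i := \dim (mximage (dual_idempotent C e x i) W).
apply: (@contiguous_support D g) => //.
- by rewrite /g E0W dimv0.
- by rewrite /g E1W dimv0.
- move=> j l j_ge2 /andP[lt_jl le_l] gj0.
  have stop := raising_stop graph_e irrW endW D_ge4 (j := j).
  rewrite /g stop ?dimv0 ?lt_jl // ?j_ge2 ?(ltnW (leq_trans lt_jl le_l)) // => u Wu.
  have /eqP := gj0; rewrite dimv_eq0 => /mximage_eq0P/(_ u Wu) ->.
  by rewrite !mulmx0.
- rewrite -dimW (dim_mximage_idempotents (r := D.+1) (P := dual_idempotent C e x)) //.
  + by move=> j l _ _; exact: dual_idempotentM.
  + exact: ball_idempotent_diameter.
  + by move=> j le_j; apply/mximage_subP => u; exact: (dual_idempotent_stable irrW).
Qed.
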